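(* Let $(X,\mu)$ be a non-atomic probability measure space and let $\mathcal{T}$ be a tree on $X$ with associated dyadic maximal operator $\mathcal{M}_{\mathcal{T}}$. Let $p>1$ and let $f,F$ be real numbers with $0<f\le\frac{p}{p-1}F$. Define $$E(f,F)=\sup\left\{|||\mathcal{M}_{\mathcal{T}}\phi|||_{p,\infty}\ :\ \phi\ge0,\ \int_X\phi\,d\mu=f,\ \|\phi\|_{p,\infty}=F\right\}.$$ Then $$E(f,F)=\left(\frac{p}{p-1}\right)^2F.$$
   Context: Tree: a set $\mathcal{T}$ of measurable subsets of $X$ is called a tree if: (1) $X\in\mathcal{T}$ and $\mu(I)>0$ for every $I\in\mathcal{T}$; (2) to every $I\in\mathcal{T}$ there corresponds a finite or countable subset $C(I)\subseteq\mathcal{T}$ containing at least two elements, such that the elements of $C(I)$ are pairwise disjoint subsets of $I$ and $I=\bigcup C(I)$; (3) $\mathcal{T}=\bigcup_{m\ge0}\mathcal{T}_{(m)}$, where $\mathcal{T}_{(0)}=\{X\}$ and $\mathcal{T}_{(m+1)}=\bigcup_{I\in\mathcal{T}_{(m)}}C(I)$; (4) $\lim_{m\to\infty}\sup_{I\in\mathcal{T}_{(m)}}\mu(I)=0$. Dyadic maximal operator: for $\phi\in L^1(X,\mu)$, $\mathcal{M}_{\mathcal{T}}\phi(x)=\sup\left\{\frac{1}{\mu(I)}\int_I|\phi|\,d\mu : x\in I\in\mathcal{T}\right\}$. Weak-$L^p$ quasi-norm: for measurable $\phi\ge0$ on $X$, $\|\phi\|_{p,\infty}=\sup\{\lambda\,\mu(\{\phi\ge\lambda\})^{1/p}:\lambda>0\}$.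 Integral norm on weak $L^p$: $|||\phi|||_{p,\infty}=\sup\left\{\mu(A)^{-1+\frac1p}\int_A|\phi|\,d\mu : A\subseteq X\text{ measurable},\ \mu(A)>0\right\}$. *)

(* Defs.v *)
From HB Require Import structures.
From mathcomp Require Import all_boot all_order all_algebra.
From mathcomp Require Import all_classical all_reals all_analysis.

Set Implicit Arguments.
Unset Strict Implicit.
Unset Printing Implicit Defensive.

Import Order.TTheory GRing.Theory Num.Theory.
Import numFieldNormedType.Exports.

Local Open Scope classical_set_scope.
Local Open Scope ring_scope.
Local Open Scope ereal_scope.

Section defs.
Context (d : measure_display) (X : measurableType d) (R : realType).
Implicit Types (mu : {measure set X -> \bar R}) (T : set (set X)).
Implicit Types (C : set X -> set (set X)) (p : R).

Definition non_atomic mu :=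
  forall A, measurable A -> 0 < mu A ->
    exists B, [/\ measurable B, B `<=` A, 0 < mu B & mu B < mu A].

Fixpoint tree_level C (m : nat) : set (set X) :=
  if m is m'.+1 then \bigcup_(I in tree_level C m') C I else [set setT].

(* [C I] is the set of children of [I]; only its values on [T] matter. *)
Record tree_with mu T C : Prop := TreeWith {
  tree_measurable : forall I, T I -> measurable I;
  tree_setT : T setT;
  tree_measure_gt0 : forall I, T I -> 0 < mu I;
  tree_children_sub : forall I, T I -> C I `<=` T;
  tree_children_countable : forall I, T I -> countable (C I);
  tree_children_ge2 :
    forall I, T I -> exists J K, [/\ C I J, C I K & J <> K];
  tree_children_disjoint : forall I, T I -> trivIset (C I) id;
  tree_children_cover : forall I, T I -> I = \bigcup_(J in C I) J;
  tree_levels : T = \bigcup_m tree_level C m;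
  tree_mesh :
    (fun m => ereal_sup [set mu I | I in tree_level C m]) @ \oo --> 0 }.

Definition is_tree mu T := exists C, tree_with mu T C.

Definition maximal_op mu T (phi : X -> R) (x : X) : \bar R :=
  ereal_sup [set (mu I)^-1 * \int[mu]_(y in I) `|(phi y)%:E|
            | I in [set I | T I /\ I x]].

Definition weak_Lp_norm mu p (phi : X -> R) : \bar R :=
  ereal_sup [set l%:E * mu [set x | (l <= phi x)%R] `^ p^-1
            | l in [set l : R | (0 < l)%R]].

(* Extended-real functions are allowed because a maximal function may take the
   value [+oo]. *)
Definition weak_Lp_integral_norm mu p (g : X -> \bar R) : \bar R :=
  ereal_sup [set mu A `^ (- 1 + p^-1) * \int[mu]_(x in A) `|g x|
            | A in [set A | measurable A /\ 0 < mu A]].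

Definition extremal_value mu T p (f F : R) : \bar R :=
  ereal_sup [set weak_Lp_integral_norm mu p (maximal_op mu T phi)
            | phi in [set phi : X -> R |
                [/\ measurable_fun setT phi,
                    forall x, (0 <= phi x)%R,
                    \int[mu]_x (phi x)%:E = f%:E &
                    weak_Lp_norm mu p phi = F%:E]]].

End defs.

(* Main.v *)
Require Import Defs.
From HB Require Import structures.
From mathcomp Require Import all_boot all_order all_algebra.
From mathcomp Require Import all_classical all_reals all_analysis.
From mathcomp Require Import measurable_realfun ring lra.

Import numFieldNormedType.Exports.
Import Order.TTheory GRing.Theory Num.Theory.
Local Open Scope classical_set_scope.
Local Open Scope ring_scope.

Set Implicit Arguments.
Unset Strict Implicit.
Unset Printing Implicit Defensive.

(** Upper bound: by the layer cake formula a weak L^p bound K gives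
    [\int_A g <= p/(p-1) K mu(A)^(1-1/p)]; combined with the weak type inequality
    [t mu{M phi > t} <= \int_{M phi > t} phi] it is used once to bound the weak
    quasi-norm of [M phi] by [p/(p-1) F], and once more to bound its integral norm.

    Sharpness: choose decreasing unions [E_k] of disjoint tree elements such that
    [E_(k+1)] occupies a proportion close to [1 - epsilon] of each tree element
    forming [E_k], and a uniform variable [U] of which the [E_k] are sublevel
    sets. Let [phi = F U^(-1/p)] on [0 < U < delta] and [0] elsewhere, with
    [delta] fixed by [\int phi = f]. On [E_k \ E_(k+1)] the maximal function
    dominates the averages of [phi] over the elements forming [E_k], so its
    integral there is at least about [epsilon \int_(E_k) phi]; summing the
    resulting geometric series from the first [E_j] of measure at most [delta]
    gives the constant [(p/(p-1))^2] as [epsilon] tends to [0]. *)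

(** * Truncated power tails and their integrals *)

Lemma powRN_cvgy0 (R : realType) (x : R) : 0 < x -> t `^ (- x) @[t --> +oo] --> 0.
Proof.
move=> x0; apply/cvgrPdist_le => /= e e0; near=> t.
have t0 : 0 < t by near: t; exact: nbhs_pinfty_gt.
rewrite sub0r normrN ger0_norm ?powR_ge0//.
have h : (e^-1 `^ x^-1) <= t by near: t; apply: nbhs_pinfty_ge; rewrite num_real.
rewrite powRN invf_ple ?posrE ?powR_gt0//.
rewrite -(powRr1 (a := e^-1)) ?invr_ge0 ?(ltW e0)// -(mulVf (lt0r_neq0 x0)) powRrM.
by apply: ge0_ler_powR; rewrite ?nnegrE ?powR_ge0 ?(ltW x0)// ltW.
Unshelve. all: by end_near. Qed.

(* With [a = K m^(-1/p)] this is [min m ((K/r)^p)] for [r > 0], extended by [m] to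
   [r <= 0], where the junk value [K/0 = 0] would spoil the formula. *)
Definition power_tail (R : realType) (p m a r : R) :=
  if r <= a then m else m * (a / r) `^ p.

Section power_tail.
Context (R : realType) (p m a : R).
Hypotheses (p1 : 1 < p) (a0 : 0 < a) (m0 : 0 <= m).

Lemma power_tail_ge0 r : 0 <= power_tail p m a r.
Proof. by rewrite /power_tail; case: ifP => // _; rewrite mulr_ge0// powR_ge0. Qed.

Lemma power_tailE r : a <= r -> power_tail p m a r = m * a `^ p * r `^ (- p).
Proof.
move=> ar; have r0 : 0 < r by exact: lt_le_trans ar.
have -> : power_tail p m a r = m * (a / r) `^ p.
  rewrite /power_tail; case: ifPn => // ra.
  have -> : r = a by apply/eqP; rewrite eq_le ar ra.
  by rewrite divff ?gt_eqF// powR1 mulr1.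
by rewrite powRM ?invr_ge0 ?ltW// -powR_inv1 ?ltW// -powRrM mulN1r mulrA.
Qed.

Lemma power_tail_nonincreasing : nonincreasing_fun (power_tail p m a).
Proof.
move=> r s rs; have p0 : 0 <= p by rewrite ltW// (lt_trans _ p1).
rewrite /power_tail; have [sa|sa] := leP s a; first by rewrite (le_trans rs).
have s0 : 0 < s by exact: lt_trans sa.
have [ra|ra] := leP r a.
  rewrite ler_piMr// -(@powRr0 _ (a / s)) ger_powR//.
  by rewrite divr_gt0//= ler_pdivrMr// mul1r ltW.
have r0 : 0 < r by exact: lt_trans ra.
rewrite ler_wpM2l// ge0_ler_powR// ?nnegrE ?divr_ge0// ?(ltW a0) ?(ltW s0) ?(ltW r0)//.
by rewrite ler_pM2l// lef_pV2.
Qed.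

Lemma measurable_power_tail : measurable_fun setT (power_tail p m a).
Proof. by apply: nonincreasing_measurable => //; exact: power_tail_nonincreasing. Qed.

(** The constant part on [[0, a[] contributes [m * a] and the power part on [[a, +oo[] contributes
    [m * a / (p - 1)]. This sum is the source of every factor [p / (p - 1)] below. *)
Lemma integral_power_tail :
  (\int[lebesgue_measure]_(r in `[0%R, +oo[) (power_tail p m a r)%:E =
   (m * a * (p / (p - 1)))%:E)%E.
Proof.
have p10 : 0 < p - 1 by rewrite subr_gt0.
have mE : measurable_fun setT (EFin \o power_tail p m a).
  by apply/measurable_EFinP; exact: measurable_power_tail.
have -> : `[0, +oo[%classic = `[0, a[%classic `|` `[a, +oo[%classic.
  by rewrite -itv_bndbnd_setU// bnd_simp ltW.
rewrite ge0_integral_setU//=; last 3 first.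
- exact: measurable_funTS.
- by move=> x _; rewrite lee_fin power_tail_ge0.
- apply/disj_setPS => x [] /=; rewrite !in_itv/= andbT => /andP[_ xa] ax.
  by move: (lt_le_trans xa ax); rewrite ltxx.
have -> : (\int[lebesgue_measure]_(x in `[0%R, a[) (power_tail p m a x)%:E = (m * a)%:E)%E.
  rewrite (eq_integral (cst m%:E)); last first.
    move=> x; rewrite inE/= in_itv/= => /andP[_ xa].
    by rewrite /power_tail (ltW xa).
  by rewrite integral_cst//= lebesgue_measure_itv/= lte_fin a0 oppr0 adde0 EFinM.
have -> : (\int[lebesgue_measure]_(x in `[a, +oo[) (power_tail p m a x)%:E =
           (m * a / (p - 1))%:E)%E.
  pose F (r : R) : R := - (m * a `^ p / (p - 1)) * r `^ (- (p - 1)).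
  have dF (x : R) : 0 < x -> is_derive x 1 F (m * a `^ p * x `^ (- p)).
    move=> x0; rewrite /F.
    have h := is_deriveZ (- (m * a `^ p / (p - 1))) (is_derive1_powR (- (p - 1)) x0).
    apply: is_derive_eq; rewrite /GRing.scale/=.
    have -> : - (p - 1) - 1 = - p by ring.
    by field; rewrite gt_eqF.
  transitivity (\int[lebesgue_measure]_(x in `[a, +oo[) (m * a `^ p * x `^ (- p))%:E)%E.
    by apply: eq_integral => x; rewrite inE/= in_itv/= andbT => ax; rewrite power_tailE.
  rewrite (@ge0_continuous_FTC2y _ _ F a 0).
  - rewrite -EFinB sub0r /F mulNr opprK; congr EFin.
    rewrite powRN.
    have -> : a `^ p = a * a `^ (p - 1) by rewrite mulr_powRB1 ?ltW// (lt_trans _ p1).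
    by field; rewrite !gt_eqF ?powR_gt0.
  - by move=> x _; rewrite !mulr_ge0 ?powR_ge0.
  - apply: derivable_within_continuous => x; rewrite in_itv/= andbT => ax.
    have x0 : 0 < x by exact: lt_le_trans ax.
    by apply: derivableM => //; apply: derivable_powR; rewrite in_itv/= x0.
  - rewrite -(mulr0 (- (m * a `^ p / (p - 1)))).
    by apply: cvgM; [exact: cvg_cst|exact: powRN_cvgy0].
  - by move=> x ax; have [] := dF x (lt_trans a0 ax).
  - apply: cvg_at_right_filter.
    apply: differentiable_continuous; apply/derivable1_diffP.
    by have [] := dF a a0.
  - move=> x; rewrite in_itv/= andbT => ax.
    by rewrite derive1E; have [_ ->] := dF x (lt_trans a0 ax).
by rewrite -EFinD; congr EFin; field; rewrite gt_eqF.
Qed.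
End power_tail.

(** * Layer cake formula and integrals of functions with power tails *)

Section layer_cake.
Context d (X : measurableType d) (R : realType) (mu : probability X R).
Local Open Scope ereal_scope.

Lemma measurable_superlevel (g : X -> R) (r : R) :
  measurable_fun setT g -> measurable [set x | (r < g x)%R].
Proof.
move=> mg; have := mg measurableT `]r, +oo[%classic (measurable_itv _).
rewrite setTI; congr (measurable _).
by apply/seteqP; split => x; rewrite /= in_itv/= andbT.
Qed.

Lemma measurable_superlevel_ge (g : X -> R) (r : R) :
  measurable_fun setT g -> measurable [set x | (r <= g x)%R].
Proof.
move=> mg; have := mg measurableT `[r, +oo[%classic (measurable_itv _).
rewrite setTI; congr (measurable _).
by apply/seteqP; split => x; rewrite /= in_itv/= andbT.
Qed.

(** The extension of [g] from [A] by 0 is a nonnegative random variable, so its expectation is the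
    integral of its complementary distribution function; for [r >= 0] the points outside [A] do not
    enter the superlevel sets. *)
Lemma integral_tail (A : set X) (g : X -> R) :
  measurable A -> measurable_fun setT g -> (forall x, (0 <= g x)%R) ->
  \int[mu]_(x in A) (g x)%:E =
  \int[lebesgue_measure]_(r in `[0%R, +oo[) mu (A `&` [set x | (r < g x)%R]).
Proof.
move=> mA mg g0.
have mY : measurable_fun setT (g \_ A : X -> R).
  by apply/(measurable_restrictT _ _).1 => //; exact: measurable_funTS.
pose Y : {RV mu >-> R} := mfun_Sub (mem_set mY).
have YE x : Y x = (g \_ A : X -> R) x by [].
transitivity ('E_mu[Y]).
  rewrite expectation_def integral_mkcond; apply: eq_integral => x _.
  by rewrite YE /patch; case: ifP.
rewrite ge0_expectation_ccdf; last first.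
  by move=> x; rewrite YE /patch; case: ifP.
apply: eq_integral => r; rewrite inE/= in_itv/= andbT => r0.
rewrite /ccdf /distribution /pushforward; congr (mu _).
apply/seteqP; split => x /=; rewrite in_itv/= andbT patchE.
  by case: ifPn => [/set_mem xA rg|_] //; rewrite ltNge r0.
by move=> [xA rg]; rewrite mem_set.
Qed.

Lemma measurable_tail (A : set X) (g : X -> R) :
  measurable A -> measurable_fun setT g ->
  measurable_fun setT (fun r : R => mu (A `&` [set x | (r < g x)%R])).
Proof.
move=> mA mg.
have mS r : measurable (A `&` [set x | (r < g x)%R]).
  by apply: measurableI => //; exact: measurable_superlevel.
apply: (@eq_measurable_fun _ _ _ _ _
    (EFin \o (fun r => fine (mu (A `&` [set x | (r < g x)%R]))))) => [r _ /=|].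
  by rewrite fineK// fin_num_measure.
apply/measurable_EFinP; apply: nonincreasing_measurable => // r s rs.
rewrite fine_le ?fin_num_measure// le_measure ?inE//.
by apply: setIS => x /=; exact: le_lt_trans.
Qed.

Lemma power_tailE_min (p K m t : R) : (1 < p)%R -> (0 < K)%R -> (0 < m)%R -> (0 < t)%R ->
  (power_tail p m (K * m `^ (- p^-1)) t = Num.min m ((K / t) `^ p))%R.
Proof.
move=> p1 K0 m0 t0; have p0 : (0 < p)%R by exact: lt_trans p1.
set a := (K * m `^ (- p^-1))%R.
have a0 : (0 < a)%R by rewrite mulr_gt0// powR_gt0.
have pE : (1 `^ p = 1 :> R)%R by rewrite powR1.
have at0 : (0 < a / t)%R by rewrite divr_gt0.
have aE : (m * (a / t) `^ p = (K / t) `^ p)%R.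
  have Kt : (0 <= K / t)%R by rewrite divr_ge0 ?ltW.
  rewrite /a mulrAC (powRM _ Kt) ?powR_ge0//.
  by rewrite -powRrM mulNr mulVf ?gt_eqF// powR_inv1 ?ltW// mulrCA mulfV ?mulr1// gt_eqF.
rewrite /power_tail aE; have [ta|ta] := leP t a.
  rewrite min_l// -aE ler_peMr ?(ltW m0)// -[leLHS]pE ge0_ler_powR ?nnegrE ?(ltW p0) ?(ltW at0)//.
  by rewrite ler_pdivlMr// mul1r.
rewrite min_r// -aE ger_pMr// -[leRHS]pE ge0_ler_powR ?nnegrE ?(ltW p0) ?(ltW at0)//.
by rewrite ler_pdivrMr// mul1r ltW.
Qed.

Let coefE (p K m : R) : (0 < m)%R ->
  (m * (K * m `^ (- p^-1)) * (p / (p - 1)) = p / (p - 1) * K * m `^ (1 - p^-1))%R.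
Proof.
move=> m0; rewrite powRD; last by rewrite (gt_eqF m0) implybT.
by rewrite powRr1 ?ltW//; ring.
Qed.

Lemma integral_weak_powerE (p K m : R) (A : set X) (g : X -> R) :
  (1 < p)%R -> (0 < K)%R -> (0 < m)%R ->
  measurable A -> measurable_fun setT g -> (forall x, (0 <= g x)%R) ->
  (forall t, (0 < t)%R ->
     mu (A `&` [set x | (t < g x)%R]) = (Num.min m ((K / t) `^ p))%:E) ->
  \int[mu]_(x in A) (g x)%:E = (p / (p - 1) * K * m `^ (1 - p^-1))%:E.
Proof.
move=> p1 K0 m0 mA mg g0 gt; rewrite integral_tail//.
have a0 : (0 < K * m `^ (- p^-1))%R by rewrite mulr_gt0// powR_gt0.
rewrite -coefE// -integral_power_tail ?(ltW m0)//.
(* The tails are known for [t > 0] only, so the endpoint 0, a null set, is removed first. *)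
rewrite -!(@integral_itv_obnd_cbnd _ 0%R +oo%O)/=.
- apply: eq_integral => t; rewrite inE/= in_itv/= andbT => t0.
  by rewrite gt// power_tailE_min.
- by apply: measurable_funTS; apply/measurable_EFinP; exact: (measurable_power_tail p1 a0 (ltW m0)).
- by apply: measurable_funTS; exact: measurable_tail.
Qed.


(** Inside [A] a superlevel set has measure at most the minimum of [mu A] and the weak bound, which
    is a [power_tail]; the layer cake formula then integrates it. Values in the extended reals are
    allowed so that the bound applies to maximal functions. *)
Lemma integral_weak_power_le (p K : R) (A : set X) (g : X -> \bar R) :
  (1 < p)%R -> (0 < K)%R -> 0 < mu A ->
  measurable A -> measurable_fun setT g -> (forall x, 0 <= g x) ->
  (forall t, (0 < t)%R -> mu [set x | t%:E < g x] <= ((K / t) `^ p)%:E) ->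
  \int[mu]_(x in A) g x <= (p / (p - 1) * K * fine (mu A) `^ (1 - p^-1))%:E.
Proof.
move=> p1 K0 A0 mA mg g0 gt.
have p0 : (0 < p)%R by exact: lt_trans p1.
have m0 : (0 < fine (mu A))%R by rewrite fine_gt0// A0 ltey_eq fin_num_measure.
have a0 : (0 < K * fine (mu A) `^ (- p^-1))%R by rewrite mulr_gt0// powR_gt0.
have mgy : measurable [set x | g x = +oo].
  by rewrite -[X in measurable X]setTI; exact: mg (emeasurable_set1 _).
(* At the level [K / e^(1/p)] the weak bound equals [e], and the set where [g] is infinite lies
   above every level. Hence [g] may be replaced by [fine (g x)] almost everywhere. *)
have Ny : mu [set x | g x = +oo] = 0.
  apply/eqP; rewrite eq_le measure_ge0 andbT; apply/lee_addgt0Pr => e e0.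
  have h := powR_gt0 (p^-1)%R e0.
  rewrite add0e; have := gt (K / e `^ p^-1)%R; rewrite divr_gt0// => /(_ isT).
  rewrite invf_div mulrCA mulfV ?gt_eqF// mulr1 -powRrM mulVf ?gt_eqF// powRr1 ?(ltW e0)// => h2.
  apply: (le_trans _ h2); rewrite le_measure ?inE//.
  - by rewrite -[X in measurable X]setTI; exact: emeasurable_fun_o_infty.
  - by move=> x /= ->; rewrite ltry.
have mf : measurable_fun setT (fun x => fine (g x)).
  by apply: measurableT_comp mg; exact: fine_measurable.
rewrite (@ae_eq_integral _ _ _ _ _ (fun x => (fine (g x))%:E)); last first.
- exists [set x | g x = +oo]; split => // x /= /not_implyP[Ax].
  by move: (g0 x); case: (g x).
- by apply: measurable_funTS; apply/measurable_EFinP.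
- exact: measurable_funTS.
- by [].
rewrite integral_tail//; last by move=> x; rewrite fine_ge0.
rewrite -coefE// -integral_power_tail ?(ltW m0)//.
rewrite -!(@integral_itv_obnd_cbnd _ 0%R +oo%O)/=; last 2 first.
- by apply: measurable_funTS; apply/measurable_EFinP; exact: (measurable_power_tail p1 a0 (ltW m0)).
- by apply: measurable_funTS; exact: measurable_tail.
apply: ge0_le_integral => //.
- apply: measurable_funTS; exact: measurable_tail.
- by apply: measurable_funTS; apply/measurable_EFinP; exact: (measurable_power_tail p1 a0 (ltW m0)).
- move=> t; rewrite /= in_itv/= andbT => t0.
  have mt : measurable [set x | (t < fine (g x))%R] by exact: measurable_superlevel.
  rewrite power_tailE_min// EFin_min fineK ?fin_num_measure// le_min; apply/andP; split.
    by rewrite le_measure ?inE//; exact: measurableI.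
  apply: le_trans (gt t t0); rewrite le_measure ?inE//; first exact: measurableI.
    by rewrite -[X in measurable X]setTI; exact: emeasurable_fun_o_infty.
  by move=> x [_] /=; move: (g0 x); case: (g x) => //= r; rewrite ?lte_fin ?ltry.
Qed.

End layer_cake.

(** * Countable families of sets *)

Section countable_families.
Context d (X : measurableType d) (R : realType) (mu : {measure set X -> \bar R}).
Local Open Scope ereal_scope.

Lemma countable_set_enum (S : set (set X)) : countable S ->
  exists D : (set X)^nat, [/\ forall n, S (D n) \/ D n = set0, forall I, S I -> exists n, D n = I,
    trivIset S id -> trivIset setT D & \bigcup_(I in S) I = \bigcup_n D n].
Proof.
move=> /countable_injP[h hinj].
pose D n := \bigcup_(I in [set I | S I /\ h I = n]) I.
have DE I : S I -> D (h I) = I.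
  move=> SI; apply/seteqP; split => [x [J [SJ hJ]]|x Ix]; last by exists I.
  by rewrite (hinj J I _ _ hJ) ?inE.
exists D; split.
- move=> n; have [[I [SI <-]]|noI] := pselect (exists I, S I /\ h I = n).
    by left; rewrite DE.
  by right; rewrite -subset0 => x [I [SI hI]] _; apply: noI; exists I.
- by move=> I SI; exists (h I); exact: DE.
- move=> tS i j _ _ [x [[I [SI <-] Ix] [J [SJ <-] Jx]]].
  by rewrite (tS I J)//; exists x.
- apply/seteqP; split => [x [I SI Ix]|x [n _ [I [SI _] Ix]]]; last by exists I.
  by exists (h I) => //; rewrite DE.
Qed.

Lemma countable_bigcup_measurable (S : set (set X)) :
  countable S -> (forall I, S I -> measurable I) -> measurable (\bigcup_(I in S) I).
Proof.
move=> /countable_set_enum[D [SD _ _ ->]] mS.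
by apply: bigcupT_measurable => n; have [/mS|->] := SD n.
Qed.

Lemma le_integral_disjoint_cover (S : set (set X)) (f g : X -> \bar R) :
  countable S -> trivIset S id -> (forall I, S I -> measurable I) ->
  measurable_fun setT f -> measurable_fun setT g ->
  (forall x, 0 <= f x) -> (forall x, 0 <= g x) ->
  (forall I, S I -> \int[mu]_(x in I) f x <= \int[mu]_(x in I) g x) ->
  \int[mu]_(x in \bigcup_(I in S) I) f x <= \int[mu]_(x in \bigcup_(I in S) I) g x.
Proof.
move=> cS tS mS mf mg f0 g0 fg.
have [D [SD _ /(_ tS) tD ->]] := countable_set_enum cS.
have mD n : measurable (D n) by have [/mS|->] := SD n.
rewrite !ge0_integral_bigcup//; [|exact: measurable_funTS..].
apply: lee_nneseries => [n _ _|n _]; first exact: integral_ge0.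
by have [/fg//|->] := SD n; rewrite !integral_set0.
Qed.

End countable_families.

(** * Levels of a tree *)

Section tree.
Context d (X : measurableType d) (R : realType) (mu : probability X R).
Context (T : set (set X)) (C : set X -> set (set X)).
Hypothesis treeT : tree_with mu T C.
Local Open Scope ereal_scope.

Lemma tree_level_sub m : tree_level C m `<=` T.
Proof. by move=> I mI; rewrite (tree_levels treeT); exists m. Qed.

Lemma tree_levelP I : T I -> exists m, tree_level C m I.
Proof. by rewrite {1}(tree_levels treeT) => -[m _ ?]; exists m. Qed.

Lemma tree_level_countable m : countable (tree_level C m).
Proof.
elim: m => [|m IH] /=; first exact: countable1.
by apply: bigcup_countable => // I /tree_level_sub /(tree_children_countable treeT).
Qed.

Lemma tree_countable : countable T.
Proof.
by rewrite (tree_levels treeT); apply: bigcup_countable => // m _; exact: tree_level_countable.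
Qed.

Lemma tree_level_cover m : \bigcup_(I in tree_level C m) I = setT.
Proof.
elim: m => [|m IH] /=; first by rewrite bigcup_set1.
apply/seteqP; split => // x _; have : [set: X] x by [].
rewrite -IH => -[I mI]; rewrite {1}(tree_children_cover treeT (tree_level_sub mI)).
by move=> [J IJ Jx]; exists J => //; exists I.
Qed.

Lemma tree_level_refine m n J : (m <= n)%N -> tree_level C n J ->
  exists2 I, tree_level C m I & J `<=` I.
Proof.
elim: n J => [|n IH] J; first by rewrite leqn0 => /eqP -> ?; exists J.
rewrite leq_eqVlt => /predU1P[-> ?|]; first by exists J.
rewrite ltnS => /IH{}IH /= [K /[dup] Kn /IH[I mI KI] KJ]; exists I => //.
apply: subset_trans KI; rewrite (tree_children_cover treeT (tree_level_sub Kn)).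
by move=> x Jx; exists J.
Qed.

Lemma tree_level_trivIset m : trivIset (tree_level C m) id.
Proof.
elim: m => [|m IH] /=; first by move=> I J /= -> ->.
move=> I J [I' mI' I'I] [J' mJ' J'J] [x [Ix Jx]].
have I'x : I' x by rewrite (tree_children_cover treeT (tree_level_sub mI')); exists I.
have J'x : J' x by rewrite (tree_children_cover treeT (tree_level_sub mJ')); exists J.
have IJ' : I' = J' by apply: IH => //; exists x.
apply: (tree_children_disjoint treeT (tree_level_sub mI')) => //; last by exists x.
by rewrite IJ'.
Qed.

Let fin_tree I : T I -> exists2 m : R, (0 < m)%R & mu I = m%:E.
Proof.
move=> TI; have mI := tree_measurable treeT TI.
exists (fine (mu I)); last by rewrite fineK// fin_num_measure.
by rewrite fine_gt0// (tree_measure_gt0 treeT TI) ltey_eq fin_num_measure.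
Qed.

(** * The maximal operator: measurability, weak type inequality and upper bound *)

Section maximal_op.
Variable phi : X -> R.
Hypotheses (mphi : measurable_fun setT phi) (phi0 : forall x, (0 <= phi x)%R).

Local Notation M := (maximal_op mu T phi).

Lemma maximal_op_superlevel (y : \bar R) :
  [set x | y < M x] = \bigcup_(I in [set I | T I /\
    y < (mu I)^-1 * \int[mu]_(z in I) `|(phi z)%:E|]) I.
Proof.
apply/seteqP; split => [x /=|x [I [TI yI] Ix]] /=.
  by move=> /ereal_sup_gt[_ [I [TI Ix] <-]] yI; exists I.
by apply: lt_le_trans yI _; apply: ereal_sup_ubound; exists I.
Qed.

Lemma maximal_op_ge I x : T I -> I x ->
  (mu I)^-1 * \int[mu]_(z in I) `|(phi z)%:E| <= M x.
Proof. by move=> TI Ix; apply: ereal_sup_ubound; exists I. Qed.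

Lemma maximal_op_ge0 x : 0 <= M x.
Proof.
apply: le_trans (maximal_op_ge (tree_setT treeT) (I : [set: X] x)).
by rewrite mule_ge0// ?inve_ge0// integral_ge0.
Qed.

Lemma measurable_maximal_op_superlevel (y : \bar R) : measurable [set x | y < M x].
Proof.
rewrite maximal_op_superlevel; set S := [set I | _].
have ST : S `<=` T by move=> I [].
apply: countable_bigcup_measurable => [|I /ST]; last exact: (tree_measurable treeT).
exact: sub_countable (subset_card_le ST) tree_countable.
Qed.

Lemma measurable_maximal_op : measurable_fun setT M.
Proof.
move=> mD; apply: (measurability _ (ErealGenOInfty.measurableE R)) => //.
move=> _ [_ [y ->] <-]; rewrite setTI.
rewrite (_ : _ @^-1` _ = [set x | y%:E < M x]); first exact: measurable_maximal_op_superlevel.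
by apply/seteqP; split => x /=; rewrite in_itv/= andbT.
Qed.

(* The maximal tree elements on which the average of [phi] exceeds [r] partition
   the superlevel set of the maximal function. *)
Lemma maximal_op_weak_type (r : R) : (0 <= r)%R ->
  r%:E * mu [set x | r%:E < M x] <= \int[mu]_(x in [set x | r%:E < M x]) (phi x)%:E.
Proof.
move=> r0; pose avg I := (mu I)^-1 * \int[mu]_(z in I) `|(phi z)%:E|.
pose S := [set I | r%:E < avg I /\ exists2 m, tree_level C m I &
  forall k J, (k < m)%N -> tree_level C k J -> I `<=` J -> avg J <= r%:E].
have ST : S `<=` T by move=> I [_ [m /tree_level_sub]].
have cS : countable S := sub_countable (subset_card_le ST) tree_countable.
have SE : [set x | r%:E < M x] = \bigcup_(I in S) I.
  rewrite maximal_op_superlevel; apply/seteqP; split=> x; last first.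
    by move=> [I /[dup] /ST TI [rI _] Ix]; exists I.
  move=> [I [/tree_levelP[n nI] rI] Ix].
  pose P m := `[< exists I, [/\ tree_level C m I, I x & r%:E < avg I] >].
  have exP : exists m, P m by exists n; apply/asboolP; exists I.
  case: (ex_minnP exP) => m /asboolP[J [mJ Jx rJ]] mmin; exists J => //; split => //.
  exists m => // k K km kK JK; rewrite leNgt; apply/negP => rK.
  have /mmin : P k by apply/asboolP; exists K; split => //; exact: JK.
  by rewrite leqNgt km.
have tS : trivIset S id.
  (* If two selected elements meet, refinement puts the one of higher level inside the one of lower
     level. A strict difference of levels would contradict the maximality of the smaller element. *)
  have le_meet I J m n x : tree_level C m I -> tree_level C n J -> (m <= n)%N ->
      I x -> J x -> r%:E < avg I ->
      (forall k K, (k < n)%N -> tree_level C k K -> J `<=` K -> avg K <= r%:E) -> I = J.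
    move=> mI nJ mn Ix Jx rI Jmin; have [K mK JK] := tree_level_refine mn nJ.
    have KI : K = I by apply: (tree_level_trivIset mK mI); exists x; split => //; exact: JK.
    move: mn; rewrite leq_eqVlt => /predU1P[mn|mn].
      by subst n; apply: (tree_level_trivIset mI nJ); exists x.
    by have := Jmin m K mn mK JK; rewrite KI leNgt rI.
  move=> I J [rI [m mI Imin]] [rJ [n nJ Jmin]] [x [Ix Jx]].
  have [mn|/ltnW nm] := leqP m n; first exact: (le_meet _ _ m n x).
  by apply/esym; exact: (le_meet _ _ n m x).
rewrite -integral_cst; last exact: measurable_maximal_op_superlevel.
rewrite SE; apply: le_integral_disjoint_cover => //.
- by move=> I /ST; exact: (tree_measurable treeT).
- exact/measurable_EFinP.
move=> I /[dup] /ST TI [rI _]; have mI := tree_measurable treeT TI.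
rewrite integral_cst//; move: rI; rewrite /avg.
have [m m0 mE] := fin_tree TI; rewrite mE inver gt_eqF//.
have -> : \int[mu]_(z in I) `|(phi z)%:E| = \int[mu]_(z in I) (phi z)%:E.
  by apply: eq_integral => z _; rewrite gee0_abs// lee_fin.
by move=> /ltW; rewrite lee_pdivlMl// => h; apply: le_trans h; rewrite -mE muleC.
Qed.

Variables (p F : R).
Hypotheses (p1 : (1 < p)%R) (F0 : (0 < F)%R).

Lemma weak_Lp_norm_tail (g : X -> R) (t : R) : measurable_fun setT g ->
  weak_Lp_norm mu p g <= F%:E -> (0 < t)%R ->
  mu [set x | (t <= g x)%R] <= ((F / t) `^ p)%:E.
Proof.
move=> mg gF t0; have p0 : (0 < p)%R by exact: lt_trans p1.
have mS : measurable [set x | (t <= g x)%R] by exact: measurable_superlevel_ge.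
have : t%:E * mu [set x | (t <= g x)%R] `^ p^-1 <= F%:E.
  by apply: le_trans gF; apply: ereal_sup_ubound; exists t.
rewrite -(fineK (fin_num_measure mu _ mS)); set m := fine _.
have m0 : (0 <= m)%R by rewrite fine_ge0.
rewrite poweR_EFin -EFinM !lee_fin -ler_pdivlMl// mulrC => h.
rewrite -(powRr1 m0) -(mulVf (lt0r_neq0 p0)) powRrM.
by rewrite ge0_ler_powR ?nnegrE ?powR_ge0 ?(ltW p0)// divr_ge0 ?ltW.
Qed.

(** With [e] the measure of the superlevel set [E], the weak type inequality and the integral bound
    for [phi] on [E] give [t * e <= p / (p - 1) * F * e^(1 - 1/p)]. Dividing by [e^(1 - 1/p)] leaves
    a bound on [t * e^(1/p)]; the case [e = 0] is separated for this division. *)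
Lemma maximal_op_tail (t : R) : weak_Lp_norm mu p phi <= F%:E -> (0 < t)%R ->
  mu [set x | t%:E < M x] <= ((p / (p - 1) * F / t) `^ p)%:E.
Proof.
move=> phiF t0; have p0 : (0 < p)%R by exact: lt_trans p1.
have p10 : (0 < p - 1)%R by rewrite subr_gt0.
have mE := measurable_maximal_op_superlevel t%:E.
have := maximal_op_weak_type (ltW t0); move: mE; set E := [set x | _] => mE h.
have [E0|E0] := eqVneq (mu E) 0; first by rewrite E0 lee_fin powR_ge0.
have {}E0 : 0 < mu E by rewrite lt0e E0 measure_ge0.
have mphi' : measurable_fun setT (EFin \o phi) by exact/measurable_EFinP.
have := @integral_weak_power_le _ _ _ mu p F E (EFin \o phi) p1 F0 E0 mE mphi' phi0.
have phit u : (0 < u)%R -> mu [set x | u%:E < (EFin \o phi) x] <= ((F / u) `^ p)%:E.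
  move=> u0; apply: le_trans (weak_Lp_norm_tail mphi phiF u0).
  rewrite le_measure ?inE//.
  - rewrite -[X in measurable X]setTI; exact: emeasurable_fun_o_infty.
  - exact: measurable_superlevel_ge.
  - by move=> x /=; rewrite lte_fin; exact: ltW.
move=> /(_ phit) h2; have := le_trans h h2.
have e0 : (0 < fine (mu E))%R by rewrite fine_gt0// E0 ltey_eq fin_num_measure.
rewrite -{1 3}(fineK (fin_num_measure mu _ mE)); move: e0; set e := fine _ => e0.
rewrite -EFinM !lee_fin powRD; last by rewrite (gt_eqF e0) implybT.
rewrite powRr1 ?(ltW e0)// powRN mulrA ler_pdivlMr ?powR_gt0// mulrAC.
rewrite ler_pM2r// => h3.
rewrite -[leLHS](powRr1 (ltW e0)) -[X in (_ `^ X <= _)%R](mulVf (lt0r_neq0 p0)) powRrM.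
rewrite ge0_ler_powR ?nnegrE ?powR_ge0 ?(ltW p0)//.
  by rewrite !mulr_ge0 ?invr_ge0// ltW.
by rewrite ler_pdivlMr// mulrC.
Qed.

(** This is the second use of the integral bound, now for the maximal function with weak constant
    [p / (p - 1) * F]; the powers of [mu A] cancel. *)
Lemma maximal_op_integral_norm_le : weak_Lp_norm mu p phi <= F%:E ->
  weak_Lp_integral_norm mu p M <= ((p / (p - 1)) ^+ 2 * F)%:E.
Proof.
move=> phiF; have p0 : (0 < p)%R by exact: lt_trans p1.
have p10 : (0 < p - 1)%R by rewrite subr_gt0.
apply: ge_ereal_sup => _ [A [mA A0] <-].
have K0 : (0 < p / (p - 1) * F)%R by rewrite mulr_gt0// divr_gt0.
have := integral_weak_power_le p1 K0 A0 mA measurable_maximal_op maximal_op_ge0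
  (fun t => @maximal_op_tail t phiF).
have e0 : (0 < fine (mu A))%R by rewrite fine_gt0// A0 ltey_eq fin_num_measure.
have -> : \int[mu]_(x in A) `|M x| = \int[mu]_(x in A) M x.
  by apply: eq_integral => z _; rewrite gee0_abs// maximal_op_ge0.
move: e0; have := esym (fineK (fin_num_measure mu _ mA)); set e := fine _ => muE e0 h.
suff H m : m = e%:E -> m `^ (- 1 + p^-1) * \int[mu]_(x in A) M x <=
    ((p / (p - 1)) ^+ 2 * F)%:E by exact: H muE.
move=> ->; rewrite poweR_EFin; apply: le_trans (lee_wpmul2l _ h) _; first by rewrite lee_fin powR_ge0.
rewrite -EFinM lee_fin mulrCA -powRD; last by rewrite (gt_eqF e0) implybT.
by rewrite addrACA addNr addrN addr0 powRr0 mulr1 mulrA -expr2.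
Qed.

End maximal_op.
End tree.

(** * Injective coding of 0/1 sequences by reals *)

Section ternary.
Context (R : realType).
Implicit Types b : nat -> bool.

(* Base 3 and not 2, so that distinct 0/1 sequences have distinct sums. *)
Definition ternary_sum b n : R := \sum_(k < n) (b k)%:R * 3^-1 ^+ k.

Definition ternary b : R := sup (range (ternary_sum b)).

Let ternary_sumS b n : ternary_sum b n.+1 = ternary_sum b n + (b n)%:R * 3^-1 ^+ n.
Proof. by rewrite /ternary_sum big_ord_recr. Qed.

Let pow_gt0 n : 0 < 3^-1 ^+ n :> R.
Proof. by rewrite exprn_gt0// invr_gt0. Qed.

Lemma ternary_sum_nondecreasing b : nondecreasing_seq (ternary_sum b).
Proof.
apply/nondecreasing_seqP => n; rewrite ternary_sumS lerDl mulr_ge0//.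
Qed.

(** The term [3 / 2 * 3^-1 ^+ n] is the full geometric tail from index [n] on, so the partial sum
    plus this tail can only decrease. *)
Let ternary_sum_le b n N : (n <= N)%N ->
  ternary_sum b N + 3 / 2 * 3^-1 ^+ N <= ternary_sum b n + 3 / 2 * 3^-1 ^+ n.
Proof.
move=> /subnK <-; elim: (N - n)%N => [|k]; first by rewrite add0n.
apply: le_trans; rewrite addSn ternary_sumS exprS.
by have := pow_gt0 (k + n); case: (b _) => /=; lra.
Qed.

Let ternary_ub b n : ubound (range (ternary_sum b)) (ternary_sum b n + 3 / 2 * 3^-1 ^+ n).
Proof.
move=> _ [N _ <-]; have [nN|/ltnW Nn] := leqP n N.
  by have := ternary_sum_le b nN; have := pow_gt0 N; lra.
by have := ternary_sum_nondecreasing b Nn; have := pow_gt0 n; lra.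
Qed.

Let ternary_has_ub b : has_ubound (range (ternary_sum b)).
Proof. by exists (ternary_sum b 0 + 3 / 2 * 3^-1 ^+ 0); exact: ternary_ub. Qed.

Lemma ternary_sum_cvg b : ternary_sum b n @[n --> \oo] --> ternary b.
Proof. by apply: nondecreasing_cvgn; [exact: ternary_sum_nondecreasing|exact: ternary_has_ub]. Qed.

Let ternary_ge b n : ternary_sum b n <= ternary b.
Proof. by apply: ub_le_sup; [exact: ternary_has_ub|exists n]. Qed.

Let ternary_le b n : ternary b <= ternary_sum b n + 3 / 2 * 3^-1 ^+ n.
Proof. by apply: ge_sup; [exists (ternary_sum b 0); exists 0%N|exact: ternary_ub]. Qed.

Lemma ternary_bounds b : 0 <= ternary b <= 3 / 2.
Proof.
have := ternary_ge b 0; have := ternary_le b 0.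
by rewrite /ternary_sum big_ord0 expr0 => ? ?; lra.
Qed.

(** At the first index [n] where the sequences differ, the digit 1 adds [3^-n], while all later
    digits together add at most half of that. *)
Lemma ternary_inj b b' : ternary b = ternary b' -> b =1 b'.
Proof.
move=> bb' n; elim/ltn_ind: n => n IH.
have : ternary_sum b n = ternary_sum b' n.
  by apply: eq_bigr => k _; rewrite IH.
have := (ternary_ge b n.+1, ternary_ge b' n.+1).
have := (ternary_le b n.+1, ternary_le b' n.+1).
rewrite !ternary_sumS bb' exprS; have := pow_gt0 n.
by case: (b n); case: (b' n) => //= ? [? ?] [? ?] ?; lra.
Qed.

End ternary.

Lemma ternary_measurable d (X : measurableType d) (R : realType) (B : (set X)^nat) :
  (forall n, measurable (B n)) ->
  measurable_fun setT (fun x => ternary R (fun n => x \in B n)).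
Proof.
move=> mB; apply: (@measurable_fun_cvg _ _ _ _
    (fun n x => ternary_sum R (fun n => x \in B n) n)); last first.
  by move=> x _; exact: ternary_sum_cvg.
move=> n; apply: measurable_sum => k; apply: measurable_funM => //.
exact: measurable_indic.
Qed.

(** * A real function with null fibres, built from the tree *)

Section tree_separation.
Context d (X : measurableType d) (R : realType) (mu : probability X R).
Context (T : set (set X)) (C : set X -> set (set X)).
Hypothesis treeT : tree_with mu T C.
Local Open Scope ereal_scope.

Lemma tree_mesh_lt (e : R) : (0 < e)%R ->
  exists N, forall m I, (N <= m)%N -> tree_level C m I -> mu I < e%:E.
Proof.
move=> e0.
have h : nbhs (0 : \bar R) [set y | y < e%:E].
  by apply: open_nbhs_nbhs; split; [exact: open_ereal_lt_ereal|rewrite /= lte_fin].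
have [N _ HN] := tree_mesh treeT h.
exists N => m I Nm mI; apply: le_lt_trans (HN m Nm).
by apply: ereal_sup_ubound; exists I.
Qed.

(** [V] codes membership in all tree elements. By [ternary_inj] points with equal value belong to
    the same elements, so a fibre lies in a single element of each level, and the mesh condition
    makes its measure arbitrarily small. *)
Lemma tree_separation : exists2 V : X -> R, measurable_fun setT V &
  (forall x, (0 <= V x <= 3 / 2)%R) /\ (forall v, mu (V @^-1` [set v]) = 0).
Proof.
have [D [SD DT _ _]] := countable_set_enum (tree_countable treeT).
have mD n : measurable (D n) by have [/(tree_measurable treeT)|->] := SD n.
exists (fun x => ternary R (fun n => x \in D n)); first exact: ternary_measurable.
split=> [x|v]; first exact: ternary_bounds.
set Vv := _ @^-1` _.
have [->|/set0P[x Vx]] := eqVneq Vv set0; first by rewrite measure0.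
apply/eqP; rewrite eq_le measure_ge0 andbT; apply/lee_addgt0Pr => e e0; rewrite add0e.
have [N HN] := tree_mesh_lt e0.
have := tree_level_cover treeT N; move=> /seteqP[_ /(_ x I)[I NI Ix]].
apply: le_trans (ltW (HN N I (leqnn N) NI)); rewrite le_measure ?inE//.
- rewrite -[Vv]setTI; apply: (ternary_measurable mD) => //; exact: measurable_set1.
- exact: (tree_measurable treeT (tree_level_sub treeT NI)).
move=> y Vy; have [n DnI] := DT I (tree_level_sub treeT NI).
have := @ternary_inj R (fun n => x \in D n) (fun n => y \in D n) _ n.
rewrite DnI mem_set// => Iy; apply/set_mem; rewrite -Iy//.
exact: etrans Vx (esym Vy).
Qed.

End tree_separation.

(** * The distribution transform to a uniform variable *)

Section distribution_transform.
Context d (X : measurableType d) (R : realType) (mu : probability X R).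
Local Open Scope ereal_scope.

Lemma measurable_sublevel (V : X -> R) (r : R) :
  measurable_fun setT V -> measurable [set x | (V x <= r)%R].
Proof.
move=> mV; have := mV measurableT `]-oo, r]%classic (measurable_itv _).
by rewrite setTI; congr (measurable _).
Qed.

Lemma measurable_sublevel_lt (V : X -> R) (r : R) :
  measurable_fun setT V -> measurable [set x | (V x < r)%R].
Proof.
by move=> mV; have := mV measurableT `]-oo, r[%classic (measurable_itv _); rewrite setTI.
Qed.

Lemma measurable_preimage_itvoo (V : X -> R) (r s : R) :
  measurable_fun setT V -> measurable [set x | (r < V x < s)%R].
Proof.
by move=> mV; have := mV measurableT `]r, s[%classic (measurable_itv _); rewrite setTI.
Qed.

Lemma nondecreasing_bigcup_measure_le (F : (set X)^nat) (t : \bar R) :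
  (forall n, measurable (F n)) -> nondecreasing_seq F ->
  (forall n, mu (F n) <= t) -> mu (\bigcup_n F n) <= t.
Proof.
move=> mF ndF Ft.
have h := @nondecreasing_cvg_mu _ _ _ mu _ mF (bigcupT_measurable _ mF) ndF.
rewrite -(cvg_lim _ h)//; apply: lime_le; first by apply/cvg_ex; eexists; exact: h.
exact: nearW.
Qed.

(* The set in question is a sublevel set of [V], hence a nondecreasing union of
   sets [V <= v] of measure at most [t]. *)
Lemma measure_cdf_sublevel_le (V : X -> R) (t : \bar R) : measurable_fun setT V -> 0 <= t ->
  mu [set x | mu [set y | (V y <= V x)%R] <= t] <= t.
Proof.
move=> mV t0; pose J := [set v | mu [set y | (V y <= v)%R] <= t].
have Jdown u v : (u <= v)%R -> J v -> J u.
  move=> uv; apply: le_trans; rewrite le_measure ?inE//; [exact: measurable_sublevel..|].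
  by move=> y /= /le_trans; apply.
have mS : measurable [set x | J (V x)].
  have mJ : measurable J.
    apply: is_interval_measurable => u v Ju Jv w /andP[_ wv]; exact: Jdown wv Jv.
  by have := mV measurableT J mJ; rewrite setTI.
change (mu [set x | J (V x)] <= t).
(* [J] is closed downwards: it is empty, everything, or a half-line that may or may not contain its
   supremum. Without a largest element it is exhausted by the levels [n], or by
   [sup J - 1/(n+1)]. *)
have [[v0 Jv0]|/forallNP J0] := pselect (exists v, J v); last first.
  rewrite (_ : [set x | _] = set0) ?measure0// -subset0 => x /=; exact: J0.
have [JT|/existsNP[v1 Jv1]] := pselect (forall v, J v).
  apply: (@le_trans _ _ (mu (\bigcup_n [set y | (V y <= n%:R)%R]))).
    rewrite le_measure ?inE//.
      by apply: bigcupT_measurable => n; exact: measurable_sublevel.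
    move=> x _; exists (Num.bound `|V x|%R) => //=.
    by apply: (le_trans (ler_norm _)); apply/ltW/archi_boundP.
  apply: nondecreasing_bigcup_measure_le => [n|m n mn|n]; last exact: JT.
    exact: measurable_sublevel.
  by apply/subsetPset => x /= /le_trans; apply; rewrite ler_nat.
have supJ : has_sup J.
  split; first by exists v0.
  by exists v1 => u Ju; rewrite leNgt; apply/negP => /ltW /Jdown /(_ Ju).
have [Jb|Jb] := pselect (J (sup J)).
  apply: (le_trans _ Jb); rewrite le_measure ?inE//.
    exact: measurable_sublevel.
  by move=> x /= Jx; apply: ub_le_sup => //; case: supJ.
apply: (@le_trans _ _ (mu (\bigcup_n [set y | (V y <= sup J - n.+1%:R^-1)%R]))).
  rewrite le_measure ?inE//.
    by apply: bigcupT_measurable => n; exact: measurable_sublevel.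
  move=> x /= Jx; have : (V x < sup J)%R.
    rewrite lt_neqAle ub_le_sup//; last by case: supJ.
    by rewrite andbT; apply: contra_notN Jb => /eqP <-.
  rewrite -subr_gt0 => h; have h' : (0 <= (sup J - V x)^-1)%R by rewrite invr_ge0 ltW.
  exists (Num.bound (sup J - V x)^-1) => //=.
  have : ((Num.bound (sup J - V x)^-1).+1%:R^-1 <= sup J - V x)%R.
    rewrite -lef_pV2 ?posrE ?invr_gt0// invrK.
    by apply/ltW/(lt_trans (archi_boundP h')); rewrite ltr_nat.
  by move=> h2; rewrite lerBrDr addrC -lerBrDr.
apply: nondecreasing_bigcup_measure_le => [n|m n mn|n].
- exact: measurable_sublevel.
- apply/subsetPset => x /= /le_trans; apply; rewrite lerD2l lerN2.
  by rewrite lef_pV2 ?posrE// ler_nat ltnS.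
- have n0 : (0 < n.+1%:R^-1 :> R)%R by rewrite invr_gt0.
  have [e Je he] := sup_adherent n0 supJ.
  by apply: (Jdown _ e) => //; exact: ltW.
Qed.

Variable V : X -> R.
Hypotheses (mV : measurable_fun setT V) (nullV : forall v, mu (V @^-1` [set v]) = 0).

(** This is the probability integral transform: the distribution function of [V] evaluated at [V]
    itself, uniform on [0, 1] because the fibres of [V] are null. *)
Definition cdf_transform x : R := fine (mu [set y | (V y <= V x)%R]).

Local Notation U := cdf_transform.

Lemma cdf_transformE x : (U x)%:E = mu [set y | (V y <= V x)%R].
Proof. by rewrite fineK// fin_num_measure//; exact: measurable_sublevel. Qed.

Lemma measurable_cdf_transform : measurable_fun setT U.
Proof.
pose H v := fine (mu [set y | (V y <= v)%R]).
have -> : U = H \o V by [].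
apply: measurableT_comp mV; apply: nondecreasing_measurable => // u v uv.
rewrite fine_le ?fin_num_measure//; [exact: measurable_sublevel..|].
rewrite le_measure ?inE//; [exact: measurable_sublevel..|].
by move=> y /= /le_trans; apply.
Qed.

Lemma cdf_transform_le (t : R) : (0 <= t)%R -> mu [set x | (U x <= t)%R] <= t%:E.
Proof.
move=> t0; apply: le_trans (measure_cdf_sublevel_le mV (t0 : 0 <= t%:E)).
rewrite (_ : [set x | (U x <= t)%R] = [set x | mu [set y | (V y <= V x)%R] <= t%:E])//.
by apply/seteqP; split => x; rewrite /= -cdf_transformE lee_fin.
Qed.

(** The sublevel estimate is applied to [- V]. As the fibres of [V] are null, the transform of [- V]
    is [1 - U], and passing to complements turns the upper bound into a lower one. *)
Lemma cdf_transform_lt (t : R) : (t <= 1)%R -> t%:E <= mu [set x | (U x < t)%R].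
Proof.
move=> t1; have mNV : measurable_fun setT (fun x => - V x)%R by exact: measurableT_comp.
have t1' : 0 <= (1 - t)%:E by rewrite lee_fin subr_ge0.
have := measure_cdf_sublevel_le mNV t1'.
have mUt : measurable [set x | (U x < t)%R].
  by apply: measurable_sublevel_lt; exact: measurable_cdf_transform.
have UE x : mu [set y | (- V y <= - V x)%R] = (1 - U x)%:E.
  have mVx : measurable [set y | (V y <= V x)%R] by exact: measurable_sublevel.
  have mVlt : measurable [set y | (- V y <= - V x)%R] by exact: measurable_sublevel.
  have mVeq : measurable [set y | V y = V x].
    by have := mV measurableT (measurable_set1 (V x)); rewrite setTI.
  rewrite EFinB cdf_transformE -probability_setC//; apply/eqP; rewrite eq_le.
  apply/andP; split; last first.
    rewrite le_measure ?inE//; first exact: measurableC.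
    by move=> y /= /negP; rewrite -ltNge lerN2 => /ltW.
  have -> : mu (~` [set y | (V y <= V x)%R]) =
      mu (~` [set y | (V y <= V x)%R]) + mu [set y | V y = V x].
    by rewrite (nullV (V x)) adde0.
  apply: (le_trans _ (@measureU2 _ _ _ mu _ _ (measurableC mVx) mVeq)).
  rewrite le_measure ?inE//; first by apply: measurableU => //; exact: measurableC.
  move=> y /=; rewrite lerN2 le_eqVlt => /predU1P[->|h]; [by right|left].
  by apply/negP; rewrite -ltNge.
rewrite (_ : [set x | _] = ~` [set x | (U x < t)%R]).
  rewrite probability_setC// => h.
  by move: h; rewrite -(fineK (fin_num_measure mu _ mUt)) -EFinB !lee_fin; lra.
apply/seteqP; split=> x /=; rewrite UE lee_fin; first by move=> h; apply/negP; rewrite -leNgt; lra.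
by move=> /negP; rewrite -leNgt => h; lra.
Qed.

(** Points with [U <= 0] form a null set; they are discarded because negative powers of [U] are
    taken later. *)
Lemma measure_cdf_transform_itv (t : R) : (0 <= t <= 1)%R ->
  t%:E <= mu [set x | (0 < U x < t)%R].
Proof.
move=> /andP[t0 t1]; apply: (le_trans (cdf_transform_lt t1)).
have mU := measurable_cdf_transform.
have mU0 : measurable [set x | (U x <= 0)%R] by exact: measurable_sublevel.
have mUt : measurable [set x | (0 < U x < t)%R] by exact: measurable_preimage_itvoo.
have mUlt : measurable [set x | (U x < t)%R] by exact: measurable_sublevel_lt.
have U0 : mu [set x | (U x <= 0)%R] = 0.
  by apply/eqP; rewrite eq_le measure_ge0 andbT; exact: (cdf_transform_le (lexx 0%R)).
rewrite -[leRHS]adde0 -U0.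
apply: (le_trans _ (@measureU2 _ _ _ mu _ _ mUt mU0)).
rewrite le_measure ?inE//; first exact: measurableU.
by move=> x /= ->; rewrite andbT; have [h|h] := leP (U x) 0%R; [right|left].
Qed.

End distribution_transform.

(** * A uniform variable adapted to a decreasing sequence of sets *)

Section adapted_uniform.
Context d (X : measurableType d) (R : realType) (mu : probability X R).
Variables (V : X -> R) (E : (set X)^nat) (K : nat).
Hypotheses (mV : measurable_fun setT V) (Vbnd : forall x, 0 <= V x <= 3 / 2).
Hypothesis nullV : forall v, mu (V @^-1` [set v]) = 0%E.
Hypotheses (mE : forall k, measurable (E k)) (niE : nonincreasing_seq E).

(* [depth] counts the [E k] containing [x]; since [V] takes values in [0, 3/2],
   subtracting [2 * depth] makes every [E k] an initial segment for [W]. *)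
Let depth x : nat := \sum_(k < K) (x \in E k).
Let W x : R := V x - 2 * (depth x)%:R.

Let depth_lt k x y : (k < K)%N -> E k x -> ~ E k y -> (depth y < depth x)%N.
Proof.
move=> kK Ekx Eky; rewrite /depth [ltnLHS](bigD1 (Ordinal kK))//= [ltnRHS](bigD1 (Ordinal kK))//=.
rewrite (mem_set Ekx) (memNset Eky).
rewrite add0n add1n ltnS; apply: leq_sum => i _; case: (boolP (y \in E i)) => // /set_mem Eiy.
suff /mem_set -> : E i x by [].
have [ki|/ltnW ik] := leqP k i.
  by exfalso; apply: Eky; have /subsetPset := niE ki; apply.
by have /subsetPset := niE ik; apply.
Qed.

Let W_lt k x y : (k < K)%N -> E k x -> ~ E k y -> W x < W y.
Proof.
move=> kK Ekx Eky; have := depth_lt kK Ekx Eky.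
rewrite -(ler_nat R) -natr1 /W; have := Vbnd x; have := Vbnd y; lra.
Qed.

Let mW : measurable_fun setT W.
Proof.
have -> : W = (fun x => V x - 2 * \sum_(k < K) (\1_(E k) x : R)).
  by apply/funext => x; rewrite /W /depth natr_sum.
apply: measurable_funB => //; apply: measurable_funM => //.
by apply: measurable_sum => k; exact: measurable_indic.
Qed.

(** The depth is a natural number, so a fibre of [W] is covered by countably many fibres of [V]. *)
Let nullW v : mu (W @^-1` [set v]) = 0%E.
Proof.
have mWv : measurable (W @^-1` [set v]).
  by have := mW measurableT (measurable_set1 v); rewrite setTI.
have : mu.-negligible (\bigcup_n (V @^-1` [set v + 2 * n%:R])).
  apply: negligible_bigcup => n; exists (V @^-1` [set v + 2 * n%:R]); split => //.
  by have := mV measurableT (measurable_set1 (v + 2 * n%:R)); rewrite setTI.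
  exact: nullV.
move=> /(negligibleS _) h; apply/negligibleP => //; apply: h => x /= Wx.
by exists (depth x) => //=; rewrite -Wx /W subrK.
Qed.

(** Take the transform of [W]. As [W] is smaller on [E k] than off it, [U <= mu (E k)] on [E k] and
    [U >= mu (E k)] outside. Hence [E k] with [0 < U < t] agrees, up to the boundary value, with
    [0 < U < Num.min m t]. *)
Lemma adapted_uniform : exists2 U : X -> R, measurable_fun setT U &
  forall k t, (k < K)%N -> 0 <= t <= 1 ->
    mu (E k `&` [set x | 0 < U x < t]) = (Num.min (fine (mu (E k))) t)%:E.
Proof.
exists (cdf_transform mu W); first exact: measurable_cdf_transform.
set U := cdf_transform mu W; move=> k t kK /andP[t0 t1].
have mU : measurable_fun setT U by exact: measurable_cdf_transform.
set m := fine (mu (E k)).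
have mEk : mu (E k) = m%:E by rewrite fineK// fin_num_measure.
have m0 : 0 <= m by rewrite fine_ge0.
have UE x : E k x -> U x <= m.
  move=> Ex; rewrite -lee_fin -mEk cdf_transformE// le_measure ?inE//.
    exact: measurable_sublevel.
  by move=> y /= Wy; apply: contrapT => /(W_lt kK Ex); rewrite ltNge Wy.
have UNE x : ~ E k x -> m <= U x.
  move=> Ex; rewrite -lee_fin -mEk cdf_transformE// le_measure ?inE//.
    exact: measurable_sublevel.
  by move=> y /= Ey; apply/ltW/(W_lt kK).
apply/eqP; rewrite eq_le; apply/andP; split.
  have s0 : 0 <= Num.min m t by rewrite le_min m0.
  apply: (le_trans _ (@cdf_transform_le _ _ _ mu W mW _ s0)); rewrite le_measure ?inE//.
  - by apply: measurableI => //; exact: measurable_preimage_itvoo.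
  - exact: measurable_sublevel.
  - by move=> x [/UE Ux] /= /andP[_ /ltW Ut]; rewrite le_min Ux.
have s01 : 0 <= Num.min m t <= 1 by rewrite le_min m0 t0 ge_min t1 orbT.
have := @measure_cdf_transform_itv _ _ _ mu W mW nullW _ s01.
move=> /le_trans; apply; rewrite le_measure ?inE//.
- exact: measurable_preimage_itvoo.
- by apply: measurableI => //; exact: measurable_preimage_itvoo.
- move=> x /= /andP[U0]; rewrite lt_min => /andP[Um Ut]; split; last by rewrite U0.
  by apply: contrapT => /UNE; rewrite leNgt Um.
Qed.

End adapted_uniform.

(** * Selection of nested unions of tree elements *)

Section tree_selection.
Context d (X : measurableType d) (R : realType) (mu : probability X R).
Context (T : set (set X)) (C : set X -> set (set X)).
Hypothesis treeT : tree_with mu T C.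
Local Open Scope ereal_scope.

Lemma tree_level_cover_sub m n I : (m <= n)%N -> tree_level C m I ->
  \bigcup_(J in [set J | tree_level C n J /\ J `<=` I]) J = I.
Proof.
move=> mn mI; apply/seteqP; split => [x [J [_ JI] Jx]|x Ix]; first exact: JI.
have /seteqP[_ /(_ x Logic.I)[J nJ Jx]] := tree_level_cover treeT n.
exists J => //; split => //; have [I' mI' JI'] := tree_level_refine treeT mn nJ.
suff -> : I = I' by [].
by apply: (tree_level_trivIset treeT mI mI'); exists x; split => //; exact: JI'.
Qed.

Variables s r : R.
Hypotheses (s0 : (0 < s)%R) (sr : (s < r)%R) (r1 : (r < 1)%R).

(** Elements of a fine level inside [I], each of measure below [(r - s) * mu I], are added one by
    one until the total first exceeds [r * mu I]; this happens because [r < 1]. Dropping the last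
    one leaves a total between the two bounds. *)
Lemma tree_select I : T I -> exists S : set (set X),
  [/\ S `<=` T, trivIset S id, forall J, S J -> J `<=` I &
      s%:E * mu I <= mu (\bigcup_(J in S) J) <= r%:E * mu I].
Proof.
move=> TI; have mI := tree_measurable treeT TI.
have [i i0 muI] : exists2 i : R, (0 < i)%R & mu I = i%:E.
  exists (fine (mu I)); last by rewrite fineK// fin_num_measure.
  by rewrite fine_gt0// (tree_measure_gt0 treeT TI) ltey_eq fin_num_measure.
have [m lI] := tree_levelP treeT TI.
have e0 : (0 < (r - s) * i)%R by rewrite mulr_gt0// subr_gt0.
have [N HN] := tree_mesh_lt treeT e0.
(* [n >= m] makes the elements of level [n] inside [I] cover it, and [n >= N] makes them small. *)
pose n := maxn m N; pose L := [set J | tree_level C n J /\ J `<=` I].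
have LT : L `<=` T by move=> J [/(tree_level_sub treeT)].
have tL : trivIset L id.
  by move=> J K [nJ _] [nK _]; exact: (tree_level_trivIset treeT nJ nK).
have LI : \bigcup_(J in L) J = I by apply: (tree_level_cover_sub _ lI); exact: leq_maxl.
have cL : countable L := sub_countable (subset_card_le LT) (tree_countable treeT).
have [D [LD _ _ LDE]] := countable_set_enum cL.
have mD k : measurable (D k) by have [/LT/(tree_measurable treeT)|->] := LD k.
have Dlt k : mu (D k) < ((r - s) * i)%:E.
  have [[nD _]|->] := LD k; last by rewrite measure0 lte_fin.
  by apply: HN nD; exact: leq_maxr.
pose F k := \bigcup_(j in `I_k) D j.
have mF k : measurable (F k) by apply: bigcup_measurable.
have F_I : \bigcup_k F k = I.
  rewrite -LI LDE; apply/seteqP; split => [x [k _ [j _ Djx]]|x [k _ Dkx]]; first by exists j.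
  by exists k.+1 => //; exists k => //=.
have ndF : nondecreasing_seq F.
  by move=> k l kl; apply/subsetPset => x [j /= jk Djx]; exists j => //=; exact: leq_trans kl.
pose P k := r%:E * mu I < mu (F k).
have exP : exists k, P k.
  apply: contrapT => /forallNP nP.
  have : mu (\bigcup_k F k) <= r%:E * mu I.
    by apply: nondecreasing_bigcup_measure_le => // k; rewrite leNgt; apply/negP; exact: nP.
  by rewrite F_I muI -EFinM lee_fin leNgt gtr_pMl// r1.
case: (ex_minnP exP) => -[|k] Pk kmin.
  move: Pk; rewrite /P /F II0 bigcup_set0 measure0 muI -EFinM lte_fin ltNge.
  by rewrite mulr_ge0// ?ltW// (lt_trans s0).
have Fk : mu (F k) <= r%:E * mu I.
  by rewrite leNgt; apply/negP => /kmin; rewrite ltnn.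
exists [set J | L J /\ exists2 j, (j < k)%N & D j = J].
have -> : \bigcup_(J in [set J | L J /\ exists2 j, (j < k)%N & D j = J]) J = F k.
  apply/seteqP; split => [x [J [_ [j jk <-]] Jx]|x [j jk Djx]]; first by exists j.
  exists (D j) => //; split; last by exists j.
  by have [//|D0] := LD j; move: Djx; rewrite D0.
split.
- by move=> J [/LT].
- by move=> J K [LJ _] [LK _]; exact: tL.
- by move=> J [[]].
rewrite Fk andbT; move: Pk; rewrite /P => Pk.
have : mu (F k.+1) <= mu (F k) + mu (D k).
  apply: (le_trans _ (@measureU2 _ _ _ mu _ _ (mF k) (mD k))).
  rewrite le_measure ?inE//; first exact: measurableU.
  move=> x [j /=]; rewrite ltnS leq_eqVlt => /predU1P[->|jk] Djx; [by right|left].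
  by exists j.
move=> /(lt_le_trans Pk); have := Dlt k.
rewrite muI -(fineK (fin_num_measure mu _ (mF k))) -(fineK (fin_num_measure mu _ (mD k))).
by rewrite -!EFinM -EFinD !lte_fin lee_fin mulrBl; lra.
Qed.

(** [tree_select] is iterated from the whole space, inside every element chosen so far. For a chosen
    [I], the maximal function is at least the average of [phi] over [I], and [I] minus [E k.+1]
    keeps a proportion at least [1 - r] of [I]; summing over [I] gives the last clause. *)
Lemma nested_selection : exists E : (set X)^nat,
  [/\ E 0%N = setT, forall k, measurable (E k), nonincreasing_seq E,
      forall k, s%:E * mu (E k) <= mu (E k.+1) <= r%:E * mu (E k) &
      forall (phi : X -> R) k, measurable_fun setT phi -> (forall x, (0 <= phi x)%R) ->
        (1 - r)%:E * \int[mu]_(x in E k) (phi x)%:E <=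
        \int[mu]_(x in E k `\` E k.+1) maximal_op mu T phi x].
Proof.
have /choice[Sel SelP] : forall I, exists S : set (set X), T I ->
    [/\ S `<=` T, trivIset S id, forall J, S J -> J `<=` I &
      s%:E * mu I <= mu (\bigcup_(J in S) J) <= r%:E * mu I].
  move=> I; have [/tree_select[S HS]|TI] := pselect (T I); first by exists S.
  by exists set0.
pose S := fix S k := if k is k'.+1 then \bigcup_(I in S k') Sel I else [set setT].
have ST k : S k `<=` T.
  elim: k => [|k IH] I /=; first by move=> ->; exact: tree_setT treeT.
  by move=> [J /IH/SelP[SJ _ _ _] /SJ].
have cS k : countable (S k) := sub_countable (subset_card_le (ST k)) (tree_countable treeT).
have mS k I : S k I -> measurable I by move=> /ST; exact: (tree_measurable treeT).
have tS k : trivIset (S k) id.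
  elim: k => [|k IH] /=; first by move=> I J /= -> ->.
  move=> I J [I' SI' I'I] [J' SJ' J'J] [x [Ix Jx]].
  have [_ tI' I's _] := SelP _ (ST _ _ SI'); have [_ _ J's _] := SelP _ (ST _ _ SJ').
  have IJ' : I' = J' by apply: IH => //; exists x; split; [exact: (I's I)|exact: (J's J)].
  by subst J'; apply: tI' => //; exists x.
pose E k := \bigcup_(I in S k) I.
have mE k : measurable (E k) by exact: (countable_bigcup_measurable (cS k) (@mS k)).
have niE : nonincreasing_seq E.
  apply/nonincreasing_seqP => k; apply/subsetPset => x [I [J SJ JI] Ix].
  by exists J => //; have [_ _ + _] := SelP _ (ST _ _ SJ); apply; [exact: JI|].
have ESel k I : S k I -> I `&` E k.+1 = \bigcup_(J in Sel I) J.
  move=> SI; apply/seteqP; split => [x [Ix [J [I' SI' I'J] Jx]]|x [J IJ Jx]].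
    have [_ _ I's _] := SelP _ (ST _ _ SI').
    have <- : I' = I by apply: (tS k) => //; exists x; split => //; exact: (I's J).
    by exists J.
  have [_ _ Is _] := SelP _ (ST _ _ SI); split; first exact: (Is J).
  by exists J => //; exists I.
have EI k I : S k I -> s%:E * mu I <= mu (I `&` E k.+1) <= r%:E * mu I.
  by move=> SI; rewrite (ESel _ _ SI); have [] := SelP _ (ST _ _ SI).
have subE k : E k `&` E k.+1 = E k.+1.
  by apply/setIidPr; have /subsetPset := niE k k.+1 (leqnSn k).
have s0' : (0 <= s)%R by exact: ltW.
have r0' : (0 <= r)%R by exact: ltW (lt_trans s0 sr).
have mindic k : measurable_fun setT (fun x : X => (\1_(E k) x : R)%:E).
  by apply/measurable_EFinP; exact: measurable_indic.
exists E; split => //.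
- by rewrite /E /= bigcup_set1.
(* Both measures are written as integrals over [E k], so that the inequalities on the separate
   elements can be summed by [le_integral_disjoint_cover]. *)
- move=> k; rewrite -!integral_cst// -[in X in _ <= X <= _](subE k) setIC.
  rewrite -integral_indic//; apply/andP; split; apply: le_integral_disjoint_cover => //.
  + exact: mS.
  + move=> I SI; rewrite integral_cst; last exact: mS SI.
    by rewrite integral_indic//; [rewrite setIC; have /andP[] := EI k I SI|exact: mS SI].
  + exact: mS.
  + move=> I SI; rewrite integral_cst; last exact: mS SI.
    by rewrite integral_indic//; [rewrite setIC; have /andP[] := EI k I SI|exact: mS SI].
- move=> phi k mphi phi0; rewrite -ge0_integralZl_EFin//; last 3 first.
  + by move=> x _; rewrite lee_fin.
  + by apply: measurable_funTS; exact/measurable_EFinP.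
  + by rewrite subr_ge0 ltW.
  have mM := measurable_maximal_op treeT phi.
  rewrite setDE integral_mkcondr; apply: le_integral_disjoint_cover => //.
  + exact: mS.
  + by apply: measurable_funeM; exact/measurable_EFinP.
  + by apply/(measurable_restrictT _ _).1; [exact: measurableC|exact: measurable_funTS].
  + by move=> x; rewrite mule_ge0// lee_fin// subr_ge0 ltW.
  + by move=> x; apply: erestrict_ge0 => y _; exact: (maximal_op_ge0 treeT).
  move=> I SI; have mI := mS _ _ SI; have TI := ST _ _ SI.
  rewrite -integral_mkcondr -setDE.
  have mIE : measurable (I `\` E k.+1) by exact: measurableD.
  set avg := (mu I)^-1 * \int[mu]_(z in I) `|(phi z)%:E|.
  have avg0 : 0 <= avg by rewrite mule_ge0// ?inve_ge0// integral_ge0.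
  apply: (@le_trans _ _ (\int[mu]_(x in I `\` E k.+1) (cst avg x))); last first.
    apply: ge0_le_integral => //; first exact: measurable_funTS.
    by move=> x [Ix _]; exact: maximal_op_ge.
  rewrite integral_cst// ge0_integralZl_EFin//; last 3 first.
  + by move=> x _; rewrite lee_fin.
  + by apply: measurable_funTS; exact/measurable_EFinP.
  + by rewrite subr_ge0 ltW.
  have muIE : (1 - r)%:E * mu I <= mu (I `\` E k.+1).
    have mIEk : measurable (I `&` E k.+1) by exact: measurableI.
    have -> : mu (I `\` E k.+1) = (fine (mu I) - fine (mu (I `&` E k.+1)))%:E.
      rewrite EFinB !fineK ?fin_num_measure//.
      by rewrite measureD// ltey_eq fin_num_measure.
    have -> : (1 - r)%:E * mu I = ((1 - r) * fine (mu I))%:E.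
      by rewrite EFinM fineK// fin_num_measure.
    have : (fine (mu (I `&` E k.+1)) <= r * fine (mu I))%R.
      by rewrite -lee_fin EFinM !fineK ?fin_num_measure//; have /andP[] := EI k I SI.
    by rewrite lee_fin mulrBl mul1r; lra.
  apply: (le_trans _ (lee_wpmul2l avg0 muIE)).
  rewrite /avg; have -> : \int[mu]_(z in I) `|(phi z)%:E| = \int[mu]_(z in I) (phi z)%:E.
    by apply: eq_integral => z _; rewrite gee0_abs// lee_fin.
  have i0 : (0 < fine (mu I))%R.
    by rewrite fine_gt0// (tree_measure_gt0 treeT TI) ltey_eq fin_num_measure.
  rewrite -(fineK (fin_num_measure mu _ mI)) inver gt_eqF// -EFinM.
  rewrite [X in _ <= X]muleC muleA -EFinM mulfK ?gt_eqF//.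
Qed.

End tree_selection.

(** * Numerical choice of the parameters *)

Lemma exprn_eventually_lt (R : realType) (a e : R) : 0 < a < 1 -> 0 < e ->
  exists n, a ^+ n < e.
Proof.
move=> /andP[a0 a1] e0.
have a1' : `|a| < 1 by rewrite ger0_norm ?ltW.
have /cvgrPdist_lt /(_ e e0)[n _ /(_ n (leqnn n))] := cvg_expr a1'.
rewrite sub0r normrN ger0_norm ?exprn_ge0 ?ltW// => h; by exists n.
Qed.

(** Put [q = 1 - p^-1] and [t = q * ((1 - s) / s)]. Young's inequality for [s^(-q)] and 1, with
    exponents [1/q] and [p], gives [s^(-q) <= 1 + t]. Then [1 - s^q <= t / (1 + t) <= t], since
    [1 + t > 0]. *)
Lemma powR_bernoulli (R : realType) (p s : R) : 1 < p -> 0 < s ->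
  1 - s `^ (1 - p^-1) <= (1 - p^-1) * ((1 - s) / s).
Proof.
move=> p1 s0; set q := 1 - p^-1; have p0 : 0 < p by exact: lt_trans p1.
have q0 : 0 < q by rewrite subr_gt0 invf_lt1.
have y0 := powR_gt0 q s0.
have : (s `^ q)^-1 * 1 <= ((s `^ q)^-1) `^ q^-1 / q^-1 + 1 `^ p / p.
  apply: conjugate_powR; rewrite ?invr_ge0 ?invr_gt0 ?(ltW y0)//.
  by rewrite invrK /q subrK.
have -> : ((s `^ q)^-1) `^ q^-1 = s^-1.
  by rewrite -powRN -powRrM mulNr mulfV ?gt_eqF// powR_inv1// ltW.
rewrite invrK powR1 mulr1 mul1r.
set z := s `^ q in y0 *; set w := s^-1 => h.
have wE : (1 - s) / s = w - 1 by rewrite mulrBl mul1r mulfV ?gt_eqF.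
rewrite wE; have zw : z^-1 <= 1 + q * (w - 1).
  by apply: le_trans h _; rewrite /q; lra.
have : 1 <= z * (1 + q * (w - 1)) by rewrite -ler_pdivrMl// mulr1.
have w0 : 0 < w by rewrite invr_gt0.
have q1 : q < 1 by rewrite /q ltrBlDr ltrDl invr_gt0.
have : 0 < 1 + q * (w - 1) by nra.
set t := q * (w - 1); nra.
Qed.

(** The right-hand factor is what [N] selection steps collect: a share [1 - r] at each step, with
    integrals shrinking by a ratio no worse than [s^(1 - 1/p)]. *)
Lemma geometric_ratio_approx (R : realType) (p theta : R) : 1 < p -> 0 < theta < 1 ->
  exists s r (N : nat), [/\ 0 < s, s < r, r < 1 & theta * (p / (p - 1)) <=
    (1 - r) * ((1 - (s `^ (1 - p^-1)) ^+ N) / (1 - s `^ (1 - p^-1)))].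
Proof.
move=> p1 /andP[t0 t1]; have p0 : 0 < p by exact: lt_trans p1.
(* Three factors [1 - x] are lost, two in the limit ratio and one in truncating the series at [N],
   and [(1 - x)^3 >= 1 - 3 * x = theta]. *)
pose x := (1 - theta) / 3; have xE : theta = 1 - 3 * x by rewrite /x; field.
have x0 : 0 < x by rewrite /x; lra.
have x1 : x < 3^-1 by rewrite /x; lra.
pose s := 1 - x; have s0 : 0 < s by rewrite /s; lra.
have s1 : s < 1 by rewrite /s; lra.
set q := 1 - p^-1; have q0 : 0 < q by rewrite subr_gt0 invf_lt1.
have qE : p / (p - 1) = q^-1.
  by rewrite /q; field; rewrite !gt_eqF ?subr_gt0.
have a0 : 0 < s `^ q by exact: powR_gt0.
have a1 : s `^ q < 1.
  have := @gt0_ltr_powR R q q0 s 1; rewrite !nnegrE powR1; apply => //; exact: ltW.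
have a01 : 0 < s `^ q < 1 by rewrite a0 a1.
have [N aN] := exprn_eventually_lt a01 x0.
(* With [r = 1 - x (1 - x)] the limit ratio is at least [(1 - x)^2 / q] by Bernoulli. *)
exists s, (1 - x * s), N; split => //.
- by rewrite /s; nra.
- by rewrite /s; nra.
have := powR_bernoulli p1 s0; rewrite -/q qE.
move: a0 a1 aN; set a := s `^ q; set b := a ^+ N => a0 a1 aN.
have -> : (1 - s) / s = x / s by rewrite /s subKr.
have -> : 1 - (1 - x * s) = x * s by rewrite subKr.
move=> h; rewrite [leRHS]mulrA ler_pdivlMr ?subr_gt0//.
have h1 : theta / q * (1 - a) <= theta * (x / s).
  rewrite -mulrA ler_wpM2l ?(ltW t0)// ler_pdivrMl//.
apply: (le_trans h1); rewrite [leLHS]mulrA ler_pdivrMr//.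
have -> : x * s * (1 - b) * s = x * (s * (1 - b) * s) by ring.
rewrite mulrC ler_wpM2l ?(ltW x0)//.
have : s * (1 - b) * s >= s * s * s.
  by rewrite ler_wpM2r ?(ltW s0)// ler_wpM2l ?(ltW s0)// /s; lra.
apply: le_trans; rewrite xE /s; nra.
Qed.

(** * The extremal function: tails, integrals and weak norm *)

Section extremal_function.
Context d (X : measurableType d) (R : realType) (mu : probability X R).
Variables (p F delta : R) (U : X -> R) (E : (set X)^nat) (K : nat).
Hypotheses (p1 : 1 < p) (F0 : 0 < F) (delta0 : 0 < delta) (delta1 : delta <= 1).
Hypotheses (mU : measurable_fun setT U) (mE : forall k, measurable (E k)).
Hypothesis E0 : forall k, (0 < mu (E k))%E.
Hypothesis UE : forall k t, (k < K)%N -> 0 <= t <= 1 ->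
  mu (E k `&` [set x | 0 < U x < t]) = (Num.min (fine (mu (E k))) t)%:E.

Definition truncated_power x : R :=
  F * U x `^ (- p^-1) * \1_[set x | 0 < U x < delta] x.

Local Notation phi := truncated_power.

Let p0 : 0 < p. Proof. exact: lt_trans p1. Qed.

Lemma measurable_truncated_power : measurable_fun setT phi.
Proof.
apply: measurable_funM; last first.
  by apply: measurable_indic; exact: measurable_preimage_itvoo.
apply: measurable_funM => //.
by apply: (@measurableT_comp _ _ _ _ _ _ (@powR R ^~ (- p^-1))).
Qed.

Lemma truncated_power_ge0 x : 0 <= phi x.
Proof. by rewrite !mulr_ge0 ?powR_ge0// ltW. Qed.

Lemma truncated_powerE x : 0 < U x < delta -> phi x = F * U x `^ (- p^-1).
Proof. by move=> Ux; rewrite /phi indicE mem_set// mulr1. Qed.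

Let lt_power (t u : R) : 0 < t -> 0 < u -> (t < F * u `^ (- p^-1)) = (u < (F / t) `^ p).
Proof.
move=> t0 u0; have v0 : 0 < F / t by rewrite divr_gt0.
have y0 := powR_gt0 p^-1 u0.
have -> : (t < F * u `^ (- p^-1)) = (u `^ p^-1 < F / t).
  by rewrite powRN ltr_pdivlMr// mulrC -ltr_pdivlMr.
apply/idP/idP => h.
  have := @gt0_ltr_powR R p p0 (u `^ p^-1) (F / t).
  by rewrite !nnegrE -powRrM mulVf ?gt_eqF// powRr1 ?(ltW u0)//; apply => //; exact: ltW.
have pV0 : 0 < p^-1 by rewrite invr_gt0.
have := @gt0_ltr_powR R p^-1 pV0 u ((F / t) `^ p).
by rewrite !nnegrE -powRrM mulfV ?gt_eqF// powRr1 ?(ltW v0)//; apply => //; rewrite ?powR_ge0// ltW.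
Qed.

Lemma measure_truncated_power_tail k t : (k < K)%N -> 0 < t ->
  mu (E k `&` [set x | t < phi x]) =
  (Num.min (Num.min (fine (mu (E k))) delta) ((F / t) `^ p))%:E.
Proof.
move=> kK t0; rewrite -minA -UE//; last first.
  by rewrite le_min (ltW delta0) powR_ge0 ge_min delta1.
congr (mu (_ `&` _)); apply/seteqP; split => x /=.
  rewrite /phi indicE; case: (boolP (x \in _)) => [/set_mem /= /andP[u0 ud]|_].
    by rewrite mulr1 lt_power// u0 lt_min ud.
  by rewrite mulr0 ltNge ltW.
rewrite lt_min => /and3P[u0 ud ut]; rewrite truncated_powerE ?u0//.
by rewrite lt_power.
Qed.

Lemma integral_truncated_power k : (k < K)%N ->
  (\int[mu]_(x in E k) (phi x)%:E)%E =
  (p / (p - 1) * F * Num.min (fine (mu (E k))) delta `^ (1 - p^-1))%:E.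
Proof.
move=> kK; apply: integral_weak_powerE => //.
- by rewrite lt_min delta0 andbT fine_gt0// E0 ltey_eq fin_num_measure.
- exact: measurable_truncated_power.
- exact: truncated_power_ge0.
- by move=> t; exact: measure_truncated_power_tail.
Qed.

Lemma weak_Lp_norm_truncated_power : (0 < K)%N -> E 0%N = setT ->
  weak_Lp_norm mu p phi = F%:E.
Proof.
move=> K0 E0T; have mphi := measurable_truncated_power.
have pV0 : 0 < p^-1 by rewrite invr_gt0.
apply/eqP; rewrite eq_le; apply/andP; split.
  apply: ge_ereal_sup => _ [l /= l0 <-]; have mS := measurable_superlevel_ge l mphi.
  have m0 := measure_ge0 mu [set x | l <= phi x].
  (* The norm uses the non-strict sets [l <= phi x], the tail formula strict ones; lowering the
     level to [theta * l] passes from one to the other. *)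
  apply/lee_mul01Pr => [|theta /andP[t0 t1]]; first by rewrite mule_ge0 ?lee_fin ?(ltW l0)// poweR_ge0.
  have tl0 : 0 < theta * l by rewrite mulr_gt0.
  rewrite muleA -EFinM.
  have : (mu [set x | (l <= phi x)%R] <= ((F / (theta * l)) `^ p)%:E)%E.
    apply: (@le_trans _ _ (mu (E 0%N `&` [set x | theta * l < phi x]))).
      rewrite E0T setTI le_measure ?inE//; first exact: measurable_superlevel.
      move=> x /=; apply: lt_le_trans; rewrite gtr_pMl//.
    by rewrite measure_truncated_power_tail// lee_fin ge_min lexx orbT.
  rewrite -(fineK (fin_num_measure mu _ mS)) poweR_EFin -EFinM !lee_fin => h.
  rewrite -ler_pdivlMl// mulrC.
  have Ft0 : 0 <= F / (theta * l) by rewrite divr_ge0 ?ltW.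
  rewrite -[leRHS](powRr1 Ft0) -[X in (_ <= _ `^ X)%R](mulfV (lt0r_neq0 p0)) powRrM.
  by rewrite ge0_ler_powR ?nnegrE ?powR_ge0 ?(ltW pV0)// ?fine_ge0.
have d0 := powR_gt0 p^-1 delta0.
(* The level [F * delta^(-1/p)] attains the supremum: [phi] is at least this on all of
   [0 < U < delta], a set of measure [delta]. *)
apply: (@le_trans _ _ ((F * delta `^ (- p^-1))%:E *
    mu [set x | (F * delta `^ (- p^-1) <= phi x)%R] `^ p^-1)%E); last first.
  apply: ereal_sup_ubound; exists (F * delta `^ (- p^-1)) => //=.
  by rewrite mulr_gt0// powR_gt0.
have mS := measurable_superlevel_ge (F * delta `^ (- p^-1)) mphi.
have : (delta%:E <= mu [set x | (F * delta `^ (- p^-1) <= phi x)%R])%E.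
  have d01 : 0 <= delta <= 1 by rewrite ltW.
  have := UE K0 d01; rewrite E0T probability_setT /= min_r// setTI => <-.
  rewrite le_measure ?inE//; first exact: measurable_preimage_itvoo.
  move=> x /= Ux; rewrite truncated_powerE// ler_pM2l// !powRN.
  have /andP[u0 ud] := Ux.
  rewrite lef_pV2 ?posrE ?powR_gt0//.
  by rewrite ge0_ler_powR ?nnegrE ?(ltW pV0) ?(ltW u0) ?(ltW ud) ?(ltW delta0).
rewrite -(fineK (fin_num_measure mu _ mS)) poweR_EFin -EFinM !lee_fin powRN => h.
rewrite -mulrA ler_peMr ?(ltW F0)// ler_pdivlMl// mulr1.
have m0 : 0 <= fine (mu [set x | F / delta `^ p^-1 <= phi x]) by rewrite fine_ge0.
by rewrite ge0_ler_powR ?nnegrE ?m0 ?(ltW pV0) ?(ltW delta0).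
Qed.

End extremal_function.

(** * Lower bound for the extremal value *)

Section lower_bound.
Context (R : realType) (d : measure_display) (X : measurableType d).
Context (mu : probability X R) (T : set (set X)) (C : set X -> set (set X)).
Hypothesis treeT : tree_with mu T C.
Variables (p f F : R).
Hypotheses (p1 : 1 < p) (f0 : 0 < f) (fF : f <= p / (p - 1) * F).
Local Notation c := (p / (p - 1)).

Lemma extremal_value_approx (theta : R) : 0 < theta < 1 ->
  exists phi : X -> R, [/\ measurable_fun setT phi, forall x, 0 <= phi x,
    (\int[mu]_x (phi x)%:E = f%:E)%E, weak_Lp_norm mu p phi = F%:E &
    ((theta * (c ^+ 2 * F))%:E <= weak_Lp_integral_norm mu p (maximal_op mu T phi))%E].
Proof.
move=> t01; have /andP[t0 t1] := t01; have p0 : 0 < p by exact: lt_trans p1.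
have c0 : 0 < c by rewrite divr_gt0// subr_gt0.
have F0 : 0 < F by rewrite -(pmulr_rgt0 _ c0); exact: lt_le_trans fF.
have cF0 : 0 < c * F by rewrite mulr_gt0.
have [s [r [N [s0 sr r1 HN]]]] := geometric_ratio_approx p1 t01.
have r0 : 0 < r by exact: lt_trans sr.
set q := 1 - p^-1 in HN; have q0 : 0 < q by rewrite subr_gt0 invf_lt1.
have [E [E0 mE niE sEr avgE]] := nested_selection treeT s0 sr r1.
have [V mV [Vbnd nullV]] := tree_separation treeT.
pose m k := fine (mu (E k)); have mEm k : mu (E k) = (m k)%:E.
  by rewrite fineK// fin_num_measure.
have m0E : m 0%N = 1 by rewrite /m E0 probability_setT.
have mS k : s * m k <= m k.+1 <= r * m k.
  by rewrite -!lee_fin !EFinM -!mEm; exact: sEr.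
have m_gt0 k : 0 < m k.
  elim: k => [|k IH]; first by rewrite m0E.
  by have /andP[+ _] := mS k; apply: lt_le_trans; rewrite mulr_gt0.
have m_le k : m k <= r ^+ k.
  elim: k => [|k IH]; first by rewrite m0E expr0.
  have /andP[_ +] := mS k; move=> /le_trans; apply.
  by rewrite exprS ler_wpM2l// ltW.
(* This solves [c * F * delta^q = f], which prescribes the total integral of [phi]; the hypothesis
   [fF] amounts to [delta <= 1]. *)
pose delta := (f / (c * F)) `^ q^-1.
have fcF0 : 0 < f / (c * F) by rewrite divr_gt0.
have delta0 : 0 < delta by exact: powR_gt0.
have delta1 : delta <= 1.
  have := @ge0_ler_powR R q^-1 _ (f / (c * F)) 1; rewrite powR1 !nnegrE; apply => //.
  - by rewrite invr_ge0 ltW.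
  - exact: ltW.
  - by rewrite ler_pdivrMr// mul1r.
have deltaq : delta `^ q = f / (c * F).
  by rewrite -powRrM mulVf ?gt_eqF// powRr1// ltW.
have r01 : 0 < r < 1 by rewrite r0.
(* From index [j] on [m k <= delta], so the truncation is no longer felt and the integral of [phi]
   over [E k] is [c * F * m k^q]. *)
have [j rj] := exprn_eventually_lt r01 delta0.
have mj k : (j <= k)%N -> m k <= delta.
  move=> jk; apply: (le_trans (m_le k)); apply: le_trans (ltW rj).
  by rewrite ler_wiXn2l// ltW.
(* The successor keeps [E 0], which yields the total integral and the weak norm, in range even if
   [j] and [N] vanish. *)
pose K := (j + N).+1.
have [U mU UE] := adapted_uniform K mV Vbnd nullV mE niE.
have muE0 k : (0 < mu (E k))%E by rewrite mEm lte_fin.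
pose phi := truncated_power p F delta U.
have mphi : measurable_fun setT phi by exact: measurable_truncated_power.
have phi0 x : 0 <= phi x by exact: truncated_power_ge0.
have intphi k : (k < K)%N ->
    (\int[mu]_(x in E k) (phi x)%:E = (c * F * Num.min (m k) delta `^ q)%:E)%E.
  by move=> kK; rewrite (integral_truncated_power p1 F0 delta0 delta1 mU mE muE0 UE).
exists phi; split => //.
- have -> : (\int[mu]_x (phi x)%:E = \int[mu]_(x in E 0%N) (phi x)%:E)%E by rewrite E0.
  rewrite intphi// m0E min_r// deltaq mulrC divfK ?gt_eqF//.
- exact: (weak_Lp_norm_truncated_power p1 F0 delta0 delta1 mU UE).
set a := s `^ q in HN.
have a0 : 0 < a by exact: powR_gt0.
have a1 : a < 1.
  have := @gt0_ltr_powR R q q0 s 1; rewrite !nnegrE powR1; apply => //; first exact: ltW.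
  exact: lt_trans r1.
have mM := measurable_maximal_op treeT phi.
have M0 := maximal_op_ge0 treeT phi.
(* By induction on the number [n] of steps: [E k] minus [E k.+1] contributes
   [(1 - r) * (c * F) * m k^q], and [E k.+1] contributes the shorter sum, scaled by
   [m k.+1^q >= a * m k^q]. *)
have lower n k : (j <= k)%N -> (k + n <= j + N)%N ->
    (((1 - r) * (c * F) * m k `^ q * ((1 - a ^+ n) / (1 - a)))%:E <=
     \int[mu]_(x in E k) maximal_op mu T phi x)%E.
  elim: n k => [|n IH] k jk kn.
    by rewrite expr0 subrr mul0r mulr0 integral_ge0.
  have kK : (k < K)%N by rewrite ltnS (leq_trans _ kn)// leq_addr.
  have /subsetPset subE := niE k k.+1 (leqnSn k).
  rewrite -(setDUK subE) ge0_integral_setU//; last 3 first.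
  - exact: measurableD.
  - exact: measurable_funTS.
  - by apply/disj_setPS => x [? []].
  have := avgE phi k mphi phi0; rewrite intphi// (min_l (mj k jk)) => h1.
  have kn' : (k.+1 + n <= j + N)%N by rewrite addSnnS.
  have h2 := IH k.+1 (leqW jk) kn'.
  rewrite addeC; apply: (le_trans _ (leeD h1 h2)); rewrite -EFinM -EFinD lee_fin.
  have /andP[sk _] := mS k.
  have mkq : a * m k `^ q <= m k.+1 `^ q.
    rewrite -powRM ?(ltW s0) ?(ltW (m_gt0 k))//.
    by rewrite ge0_ler_powR ?nnegrE ?(ltW q0) ?mulr_ge0 ?(ltW s0) ?(ltW (m_gt0 _)).
  have g0 : 0 <= (1 - r) * (c * F) * ((1 - a ^+ n) / (1 - a)).
    apply: mulr_ge0; first by rewrite mulr_ge0 ?(ltW cF0)// subr_ge0 ltW.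
    by rewrite divr_ge0 ?subr_ge0 ?exprn_ile1 ?(ltW a0) ?(ltW a1).
  have := ler_wpM2l g0 mkq.
  have -> : (1 - a ^+ n.+1) / (1 - a) = 1 + a * ((1 - a ^+ n) / (1 - a)).
    by rewrite exprS; field; rewrite gt_eqF// subr_gt0.
  set g := (1 - a ^+ n) / (1 - a); lra.
have := lower N j (leqnn j) (leqnn _).
have -> : (\int[mu]_(x in E j) maximal_op mu T phi x =
           \int[mu]_(x in E j) `|maximal_op mu T phi x|)%E.
  by apply: eq_integral => x _; rewrite gee0_abs.
move=> h.
apply: (@le_trans _ _ (mu (E j) `^ (- 1 + p^-1) *
    \int[mu]_(x in E j) `|maximal_op mu T phi x|)%E); last first.
  by apply: ereal_sup_ubound; exists (E j) => //; split; [exact: mE|exact: muE0].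
suff H M : M = (m j)%:E -> ((theta * (c ^+ 2 * F))%:E <=
    M `^ (- 1 + p^-1) * \int[mu]_(x in E j) `|maximal_op mu T phi x|)%E by exact: H (mEm j).
move=> ->; rewrite poweR_EFin.
apply: (le_trans _ (lee_wpmul2l _ h)); last by rewrite lee_fin powR_ge0.
have -> : - 1 + p^-1 = - q by rewrite /q opprB addrC.
have mjq := powR_gt0 q (m_gt0 j).
rewrite -EFinM lee_fin powRN.
have -> : (m j `^ q)^-1 * ((1 - r) * (c * F) * m j `^ q * ((1 - a ^+ N) / (1 - a))) =
    (1 - r) * ((1 - a ^+ N) / (1 - a)) * (c * F).
  move: (m j `^ q) mjq => z z0; have : z^-1 * z = 1 by rewrite mulVf ?gt_eqF.
  move: z^-1 => w wz; transitivity (w * z * ((1 - r) * ((1 - a ^+ N) / (1 - a)) * (c * F))).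
    by ring.
  by rewrite wz mul1r.
have -> : theta * (c ^+ 2 * F) = theta * c * (c * F) by rewrite expr2; ring.
by rewrite ler_wpM2r// ltW.
Qed.

End lower_bound.

(** * Combination of the upper and lower bounds *)

Unset Implicit Arguments.

Theorem theorem4p2 (R : realType) (d : measure_display) (X : measurableType d)
    (mu : probability X R) (T : set (set X)) (p f F : R)
    (mu_non_atomic : non_atomic mu) (treeT : is_tree mu T)
    (p_gt1 : 1 < p) (f_gt0 : 0 < f) (f_le : f <= p / (p - 1) * F) :
  extremal_value mu T p f F = ((p / (p - 1)) ^+ 2 * F)%:E.
Proof.
have [C tC] := treeT.
have c0 : 0 < p / (p - 1) by rewrite divr_gt0 ?subr_gt0// (lt_trans _ p_gt1).
have F0 : 0 < F by rewrite -(pmulr_rgt0 _ c0); exact: lt_le_trans f_le.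
apply/eqP; rewrite eq_le; apply/andP; split.
  apply: ge_ereal_sup => _ [phi [mphi phi0 _ phiF] <-].
  by apply: (maximal_op_integral_norm_le tC) => //; rewrite phiF.
(* It suffices to reach every fraction [theta < 1] of the claimed value. *)
apply/lee_mul01Pr => [|theta t01].
  by rewrite lee_fin mulr_ge0 ?exprn_ge0// ltW.
have [phi [mphi phi0 phif phiF]] := extremal_value_approx tC p_gt1 f_gt0 f_le t01.
rewrite -EFinM => /le_trans; apply.
by apply: ereal_sup_ubound; exists phi.
Qed.
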